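(* Let $\mathbf{X}$ be a regular $2^{n-p}$ design of resolution III or higher. Suppose $\mathbf{X}$ has $g$ alias sets, ordered so that the first $f$ of them are those that do not contain main effects, and for $1\le i\le g$ let $m_i$ be the number of two-factor interactions in the $i$th alias set. Let $g^*$, $f^*$ and $m_i^*$ be the corresponding numbers for the double $D(\mathbf{X})$. Then $g^* = 2g+1$, $f^* = 2f+1$, and, for a suitable ordering of the alias sets of $D(\mathbf{X})$ in which the first $f^*$ alias sets are those not containing main effects, $$m_1^* = m_2^* = 2m_1,\quad m_3^* = m_4^* = 2m_2,\quad \ldots,\quad m_{2f-1}^* = m_{2f}^* = 2m_f,$$ $$m_{2f+1}^* = n,$$ $$m_{2f+2}^* = m_{2f+3}^* = 2m_{f+1},\quad \ldots,\quad m_{g^*-1}^* = m_{g^*}^* = 2m_g .$$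
   Context: All designs have two levels, coded $1$ and $-1$. A design with $N$ runs and $n$ factors is an $N\times n$ matrix with entries $\pm 1$; columns correspond to factors and rows to runs. Regular design: a regular $2^{n-p}$ design ($0\le p<n$) is an $N\times n$ matrix with $N = 2^{n-p}$ whose rows are, each once, exactly the vectors $(x_1,\dots,x_n)\in\{1,-1\}^n$ satisfying $p$ equations $\prod_{i\in S_j} x_i = \varepsilon_j$, $j=1,\dots,p$, where $\varepsilon_j\in\{1,-1\}$ and the nonempty subsets $S_j\subseteq\{1,\dots,n\}$ are linearly independent in $\mathbb{F}_2^n$. A defining word is a nonempty set $S$ of factors such that the componentwise product of the corresponding columns is constant; its length is $|S|$. There are $2^p-1$ defining words. The resolution is the length of the shortest defining word (a design with no defining words has resolution higher than any integer). Factorial effects and alias sets: a factorial effect is a nonempty set of factors; a main effect is a set of size $1$ and a two-factor interaction is a set of size $2$. Two effects $S,T$ that are not defining words are aliased if the componentwise product of the columns in $S$ equals, up to sign, that of the columns in $T$ (equivalently, $S=T$ or the symmetric difference of $S$ and $T$ is a defining word). The $2^n-2^p$ effects that are not defining words are thereby partitioned into $g = 2^{n-p}-1$ alias sets, each of size $2^p$. For a regular design of resolution III or higher, exactly $f = 2^{n-p}-1-n$ of these alias sets contain no main effect. Doubling: the double of an $N\times n$ matrix $\mathbf{X}$ is the $2N\times 2n$ matrix $D(\mathbf{X}) = \begin{bmatrix}\mathbf{X}&\mathbf{X}\\ \mathbf{X}&-\mathbf{X}\end{bmatrix}$; when $\mathbf{X}$ is regular, $D(\mathbf{X})$ is a regular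 $2^{2n-(n+p-1)}$ design. *)

(* Defs.v *)
From mathcomp Require Import all_boot all_order all_algebra.

Set Implicit Arguments.
Unset Strict Implicit.
Unset Printing Implicit Defensive.

Import GRing.Theory.
Local Open Scope ring_scope.

(* A design with N runs and n factors is a matrix X : 'M[int]_(N, n); its
   entries are forced to be 1 or -1 by [regular] below. *)

Definition pm1 (a : int) : bool := (a == 1) || (a == -1).

Definition word_mx (p n : nat) (S : 'I_p -> {set 'I_n}) : 'M['F_2]_(p, n) :=
  \matrix_(j < p, i < n) (i \in S j)%:R.

Definition solution (p n : nat) (S : 'I_p -> {set 'I_n}) (eps : 'I_p -> int)
    (x : 'rV[int]_n) : bool :=
  [forall i, pm1 (x 0 i)] && [forall j, \prod_(i in S j) x 0 i == eps j].

(* In the last clause the boolean is coerced to 0 or 1: each solution occurs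
   as exactly one row of X, and no other vector occurs as a row. *)
Definition regular (p N n : nat) (X : 'M[int]_(N, n)) : Prop :=
  [/\ (p < n)%N, N = (2 ^ (n - p))%N &
    exists (S : 'I_p -> {set 'I_n}) (eps : 'I_p -> int),
      [/\ forall j, S j != set0,
          forall j, pm1 (eps j),
          row_free (word_mx S)
        & forall x : 'rV[int]_n, #|[set i | row i X == x]| = solution S eps x]].

Definition col_prod (N n : nat) (X : 'M[int]_(N, n)) (S : {set 'I_n}) :
    'cV[int]_N :=
  \col_i \prod_(j in S) X i j.

Definition defining_word (N n : nat) (X : 'M[int]_(N, n)) (S : {set 'I_n}) :
    bool :=
  (S != set0) && [forall i, forall k, col_prod X S i 0 == col_prod X S k 0].

(* [None] stands for infinity: there is no defining word. *)
Definition resolution (N n : nat) (X : 'M[int]_(N, n)) : option nat :=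
  if [pick S | defining_word X S] is Some S0
  then Some #|[arg min_(S < S0 | defining_word X S) #|S| ]|
  else None.

Definition resolution_at_least (r N n : nat) (X : 'M[int]_(N, n)) : bool :=
  if resolution X is Some l then (r <= l)%N else true.

Definition main_effect (n : nat) (S : {set 'I_n}) : bool := #|S| == 1%N.

Definition two_factor_interaction (n : nat) (S : {set 'I_n}) : bool :=
  #|S| == 2%N.

Definition estimable_effects (N n : nat) (X : 'M[int]_(N, n)) :
    {set {set 'I_n}} :=
  [set S | (S != set0) && ~~ defining_word X S].

Definition aliased (N n : nat) (X : 'M[int]_(N, n)) : rel {set 'I_n} :=
  fun S T =>
    (col_prod X S == col_prod X T) || (col_prod X S == - col_prod X T).

Definition alias_sets (N n : nat) (X : 'M[int]_(N, n)) :
    {set {set {set 'I_n}}} :=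
  equivalence_partition (aliased X) (estimable_effects X).

Definition no_main_effect (n : nat) (A : {set {set 'I_n}}) : bool :=
  [forall S in A, ~~ main_effect S].

Definition num_alias_sets (N n : nat) (X : 'M[int]_(N, n)) : nat :=
  #|alias_sets X|.

Definition num_alias_sets_no_main (N n : nat) (X : 'M[int]_(N, n)) : nat :=
  #|[set A in alias_sets X | no_main_effect A]|.

Definition alias_ordering (N n : nat) (X : 'M[int]_(N, n))
    (s : seq {set {set 'I_n}}) : Prop :=
  [/\ uniq s, s =i alias_sets X
    & forall k, (k < size s)%N ->
        no_main_effect (nth set0 s k) = (k < num_alias_sets_no_main X)%N].

(* The number m_i attached to the ordering s, with i counted from 1. *)
Definition num_tfi (n : nat) (s : seq {set {set 'I_n}}) (i : nat) : nat :=
  #|[set S in nth set0 s i.-1 | two_factor_interaction S]|.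

Definition double_design (N n : nat) (X : 'M[int]_(N, n)) :
    'M[int]_(N + N, n + n) :=
  block_mx X X X (- X).

(* Main.v *)
Require Import Defs.
From mathcomp Require Import all_boot all_order all_algebra.
From mathcomp Require Import zify.

(** View an effect of the double as a pair [(A, B)] of sets of factors of [X].
    The column product of [(A, B)] is that of the symmetric difference of [A]
    and [B] on the top half of the runs, and [(-1)^|B|] times it on the bottom
    half. So the class of [(A, B)] is given by the class of the symmetric
    difference together with the parity of [|B|]: every alias set of [X]
    splits in two, and the class of defining words of [X] (with the empty set)
    contributes one further alias set, with [|B|] odd. *)

Set Implicit Arguments.
Unset Strict Implicit.
Unset Printing Implicit Defensive.

Import GRing.Theory.

(** * Effects of the double as pairs of effects, and lifts of classes *)

Section SplitEffects.

Variable n : nat.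
Implicit Types (A B S : {set 'I_n}) (U V : {set 'I_(n + n)}).
Implicit Types (C : {set {set 'I_n}}) (b : bool) (s : seq {set {set 'I_n}}).

Definition symdiff A B : {set 'I_n} := [set i | (i \in A) (+) (i \in B)].

Definition join A B : {set 'I_(n + n)} :=
  [set k | match split k with inl i => i \in A | inr j => j \in B end].

Definition lhalf U : {set 'I_n} := [set i | lshift n i \in U].
Definition rhalf U : {set 'I_n} := [set i | rshift n i \in U].
Definition fold U : {set 'I_n} := symdiff (lhalf U) (rhalf U).
Definition parity U : bool := odd #|rhalf U|.

(** With [C] an alias set and either [b], or with [C] the class of the empty set and [b = true],
    these turn out to be the alias sets of the double. The remaining case, the class of the empty
    set with [b = false], collects the empty set and the defining words of the double. *)
Definition lift_class b C : {set {set 'I_(n + n)}} :=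
  [set U | (fold U \in C) && (parity U == b)].

Lemma symdiff0 A : symdiff A set0 = A.
Proof. by apply/setP => i; rewrite !inE addbF. Qed.

Lemma symdiffC A B : symdiff A B = symdiff B A.
Proof. by apply/setP => i; rewrite !inE addbC. Qed.

Lemma symdiffK A B : symdiff (symdiff A B) B = A.
Proof. by apply/setP => i; rewrite !inE addbK. Qed.

Lemma lhalf_join A B : lhalf (join A B) = A.
Proof. by apply/setP => i; rewrite !inE (unsplitK (inl i)). Qed.

Lemma rhalf_join A B : rhalf (join A B) = B.
Proof. by apply/setP => i; rewrite !inE (unsplitK (inr i)). Qed.

Lemma join_halves U : join (lhalf U) (rhalf U) = U.
Proof.
apply/setP => k; rewrite inE -[k in RHS]splitK.
by case: (split k) => i; rewrite inE.
Qed.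

Lemma card_halves U : #|U| = #|lhalf U| + #|rhalf U|.
Proof.
rewrite -!sum1_card big_mkcond big_split_ord /=.
by congr (_ + _); rewrite [RHS]big_mkcond; apply: eq_bigr => i _; rewrite inE.
Qed.

Lemma in_lift_class b C A B :
  (join A B \in lift_class b C) = (symdiff A B \in C) && (odd #|B| == b).
Proof. by rewrite inE /fold /parity lhalf_join rhalf_join. Qed.

Lemma card_join A B : #|join A B| = #|A| + #|B|.
Proof. by rewrite card_halves lhalf_join rhalf_join. Qed.

Lemma lift_class0 b : lift_class b set0 = set0.
Proof. by apply/setP => U; rewrite !inE. Qed.

(** The main effects of the double are the pairs [({x}, set0)] and [(set0, {x})]. Both fold to
    [{x}], the first with even and the second with odd parity, so each lift has one main effect over
    each main effect of [C]. *)
Lemma no_main_effect_lift b C :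
  no_main_effect (lift_class b C) = no_main_effect C.
Proof.
apply/forall_inP/forall_inP => noC S; last first.
  rewrite -(join_halves S) in_lift_class /main_effect card_join.
  move: (lhalf S) (rhalf S) => A B /andP[AB _]; apply/negP => /eqP cAB.
  move/noC/negP: (AB); apply; rewrite /main_effect.
  have [A0|A0] := posnP #|A|.
    by rewrite (cards0_eq A0) symdiffC symdiff0 -cAB A0.
  have B0 : #|B| = 0 by lia.
  by rewrite (cards0_eq B0) symdiff0 -cAB B0 addn0 /=.
move=> SC; apply/negP => mS.
case: b noC => noC.
- have /noC : join set0 S \in lift_class true C.
    by rewrite in_lift_class symdiffC symdiff0 SC (eqP mS).
  by rewrite /main_effect card_join cards0 (eqP mS).
- have /noC : join S set0 \in lift_class false C.
    by rewrite in_lift_class symdiff0 SC cards0.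
  by rewrite /main_effect card_join cards0 (eqP mS).
Qed.

(** When [#|A| + #|B| = 2] and [#|B|] is even, one of the two sets is empty and the other is a pair
    lying in [C]. Each pair thus arises once on the left and once on the right. *)
Lemma card_tfi_lift_false C :
  #|[set U in lift_class false C | two_factor_interaction U]|
  = 2 * #|[set S in C | two_factor_interaction S]|.
Proof.
set T := [set S in C | _].
have -> : [set U in lift_class false C | two_factor_interaction U]
    = [set join S set0 | S in T] :|: [set join set0 S | S in T].
  apply/setP => U; rewrite -(join_halves U).
  move: (lhalf U) (rhalf U) => A B.
  rewrite inE in_lift_class /two_factor_interaction card_join.
  apply/idP/setUP.
    move=> /andP[/andP[AB oB] /eqP cAB].
    have [B0|B0] := posnP #|B|.
      left; move: AB; rewrite (cards0_eq B0) symdiff0 => AC.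
      by apply/imsetP; exists A; rewrite // inE AC /two_factor_interaction -cAB B0 addn0 /=.
    have A0 : #|A| = 0 by move: B0 oB cAB; case: #|B| => [|[|m]] // _ _ /eqP;
      rewrite !addnS !eqSS addn_eq0 => /andP[/eqP].
    right; move: AB; rewrite (cards0_eq A0) symdiffC symdiff0 => BC.
    by apply/imsetP; exists B; rewrite // inE BC /two_factor_interaction -cAB A0 /=.
  case=> /imsetP[S]; rewrite inE => /andP[SC /eqP cS] eU;
    have := congr1 lhalf eU; have := congr1 rhalf eU;
    rewrite !lhalf_join !rhalf_join => -> ->.
    by rewrite symdiff0 SC cards0 cS.
  by rewrite symdiffC symdiff0 SC cards0 cS.
(* The two images are disjoint: the right half is empty in one and a pair in the other. *)
rewrite cardsU disjoint_setI0; last first.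
  apply/pred0P => U /=; apply/negP => /andP[/imsetP[S _ ->] /imsetP[S' S'T eU]].
  have := congr1 rhalf eU; rewrite !rhalf_join => S'0.
  by move: S'T; rewrite -S'0 inE /two_factor_interaction cards0 andbF.
rewrite cards0 subn0 mul2n -addnn !card_in_imset //.
  by move=> S S' _ _ /(congr1 rhalf); rewrite !rhalf_join.
by move=> S S' _ _ /(congr1 lhalf); rewrite !lhalf_join.
Qed.

(** Toggling [x] changes the size of [S] by one, so a singleton comes from adding [x] to the empty
    set or removing it from a pair. *)
Lemma symdiff_set1_card1 S x :
  (#|symdiff S [set x]| == 1) = (S == set0) || ((x \in S) && (#|S| == 2)).
Proof.
have [xS|xS] := boolP (x \in S).
  have -> : symdiff S [set x] = S :\ x.
    by apply/setP => y; rewrite !inE; case: eqP => [->|]; rewrite ?xS ?addbF.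
  have := cardsD1 x S; rewrite xS -cards_eq0 /=; lia.
have -> : symdiff S [set x] = x |: S.
  by apply/setP => y; rewrite !inE; case: eqP => [->|]; rewrite ?(negPf xS) ?addbF.
by rewrite cardsU1 xS orbF -cards_eq0.
Qed.

(* An effect [({x}, {y})] with [x = y] folds to the empty set, which is where
   the extra [n] comes from. *)
Lemma card_tfi_lift_true C :
  #|[set U in lift_class true C | two_factor_interaction U]|
  = 2 * #|[set S in C | two_factor_interaction S]| + (set0 \in C) * n.
Proof.
pose P S : {set 'I_n} := [set x | #|symdiff S [set x]| == 1].
(* Odd parity forces the right half to be some [{x}], and folding to [S] then determines the left
   half as [symdiff S [set x]]. So the interactions above [S] are indexed by those [x] for which
   this left half is a singleton. *)
have fibre S : S \in C ->
    #|[set U in lift_class true C | two_factor_interaction U & fold U == S]|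
    = #|P S|.
  move=> SC; rewrite -(@card_in_imset _ _ (fun x => join (symdiff S [set x]) [set x])).
    apply: eq_card => U; rewrite -(join_halves U).
    move: (lhalf U) (rhalf U) => A B.
    rewrite inE in_lift_class /two_factor_interaction card_join.
    rewrite /fold lhalf_join rhalf_join.
    apply/idP/imsetP => [/and3P[/andP[AB oB] cAB /eqP eS]|[x]].
      have /cards1P[x eB] : #|B| == 1.
        by move: oB cAB; case: #|B| => [|[|[|m]]] // _; rewrite !addnS.
      have eA : symdiff S [set x] = A by rewrite -eS eB symdiffK.
      by exists x; rewrite ?eA ?eB // inE eA; move: cAB; rewrite eB cards1; lia.
    rewrite inE => /eqP cx eU.
    have := congr1 lhalf eU; have := congr1 rhalf eU.
    by rewrite !lhalf_join !rhalf_join => -> ->; rewrite symdiffK SC cards1 cx eqxx.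
  by move=> x y _ _ /(congr1 rhalf); rewrite !rhalf_join => /set1_inj.
(* The empty set admits all [n] choices of [x], a pair admits its two elements, and any other set
   admits none. *)
have cardP S : #|P S| = (S == set0) * n + (#|S| == 2) * 2.
  have [->|S0] := eqVneq S set0.
    rewrite cards0 mul1n addn0 -[RHS]card_ord -cardsT.
    by apply: eq_card => x; rewrite !inE symdiff_set1_card1 eqxx.
  have [S2|S2] := eqVneq #|S| 2.
    rewrite -[in RHS]S2 mul1n; apply: eq_card => x.
    by rewrite inE symdiff_set1_card1 (negPf S0) S2 andbT.
  apply/eqP; rewrite cards_eq0; apply/eqP/setP => x.
  by rewrite !inE symdiff_set1_card1 (negPf S0) (negPf S2) andbF.
rewrite -sum1_card (partition_big fold (mem C)) /=; last first.
  by move=> U; rewrite !inE -andbA => /andP[].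
transitivity (\sum_(S in C) ((S == set0) * n + (#|S| == 2) * 2)).
  apply: eq_bigr => S SC; rewrite -cardP -fibre // -sum1_card.
  by apply: eq_bigl => U; rewrite !inE -andbA.
rewrite big_split /= -!big_distrl /= addnC; congr (_ + _ * _).
  rewrite mulnC; congr (_ * _); rewrite -sum1_card -big_mkcondr.
  by apply: eq_bigl => S; rewrite inE.
have [C0|C0] := boolP (set0 \in C).
  by rewrite (bigD1 set0) //= eqxx big1 // => S /andP[_ /negPf->].
by rewrite big1 // => S SC; case: eqP => // S0; rewrite -S0 SC in C0.
Qed.

(** Toggling one factor in both halves flips the parity and keeps the fold; [0 < n] supplies the
    factor. *)
Lemma exists_lift b S : 0 < n -> exists2 U, fold U = S & parity U = b.
Proof.
move=> n0; pose B := if b then [set Ordinal n0] else set0.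
exists (join (symdiff S B) B); rewrite /fold /parity ?lhalf_join rhalf_join.
  exact: symdiffK.
by rewrite /B; case: (b); rewrite ?cards1 ?cards0.
Qed.

(** A lift of a member of [C] reveals the parity. Since every effect has a lift of that parity, [C]
    is then recovered by folding. *)
Lemma lift_class_inj b b' C C' : 0 < n -> C != set0 ->
  lift_class b C = lift_class b' C' -> (C, b) = (C', b').
Proof.
move=> n0 /set0Pn[S SC] eL.
have eb : b = b'.
  have [U fU pU] := exists_lift b S n0.
  have : U \in lift_class b C by rewrite inE fU SC pU /=.
  by rewrite eL inE pU => /andP[_ /eqP].
rewrite -eb in eL *; congr (_, _); apply/setP => {SC}S.
have [U fU pU] := exists_lift b S n0.
by move/setP/(_ U): eL; rewrite !inE fU pU eqxx !andbT.
Qed.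

(** The two lifts of a class stand next to each other, which gives the pairs of equal numbers in the
    theorem. *)
Definition lift_seq s : seq {set {set 'I_(n + n)}} :=
  [seq lift_class b C | C <- s, b <- [:: false; true]].

(** Beyond the end both sides are the default [set0], whose lifts are empty. *)
Lemma nth_lift_seq s k :
  nth set0 (lift_seq s) k = lift_class (odd k) (nth set0 s k./2).
Proof.
elim: s k => [|C s IHs] k; first by rewrite !nth_nil lift_class0.
case: k => [|[|k]] //=.
by rewrite negbK -IHs.
Qed.

Lemma size_lift_seq s : size (lift_seq s) = 2 * size s.
Proof. by rewrite size_allpairs mulnC. Qed.

Lemma lift_seq_uniq s : 0 < n -> set0 \notin s -> uniq s -> uniq (lift_seq s).
Proof.
move=> n0 s0 us; apply: allpairs_uniq => // -[C b] [C' b'].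
move=> /allpairsP[[D c] /= [Ds _ [-> ->]]] _ /(lift_class_inj n0) -> //.
by apply: contraNneq s0 => <-.
Qed.

Lemma count_no_main_lift_seq s :
  count (@no_main_effect _) (lift_seq s) = 2 * count (@no_main_effect _) s.
Proof.
elim: s => //= C s IHs.
by rewrite -/(lift_seq s) IHs !no_main_effect_lift; lia.
Qed.

End SplitEffects.

(** * Alias sets as classes of the aliasing relation *)

Section AliasClasses.

Local Open Scope ring_scope.

Variables (N n : nat) (X : 'M[int]_(N, n)).
Hypotheses (N0 : (0 < N)%N) (X1 : forall i j, pm1 (X i j)).
Implicit Types (S T : {set 'I_n}) (U V : {set 'I_(n + n)}).

(** The class is taken among all sets, not only the estimable effects, so that [alias_class set0] is
    available: the empty set together with the defining words. *)
Definition alias_class S : {set {set 'I_n}} := [set T | aliased X S T].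

Lemma col_prod_set0 i : col_prod X set0 i 0 = 1.
Proof. by rewrite mxE big_set0. Qed.

Lemma pm1_sqr a : pm1 a -> a * a = 1.
Proof. by case/orP => /eqP->. Qed.

Lemma pm1_col_prod S i : pm1 (col_prod X S i 0).
Proof.
rewrite mxE; apply: (big_ind pm1) => // a b.
by case/orP => /eqP-> /orP[] /eqP->.
Qed.

Lemma aliased_refl S : aliased X S S.
Proof. by rewrite /aliased eqxx. Qed.

Lemma aliased_sym S T : aliased X S T = aliased X T S.
Proof. by rewrite /aliased [in RHS]eq_sym -[in RHS]eqr_oppLR [- _ == _]eq_sym. Qed.

Lemma aliased_trans : transitive (aliased X).
Proof.
rewrite /aliased => S T V /orP[]/eqP-> /orP[]/eqP->;
  by rewrite ?opprK eqxx ?orbT.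
Qed.

(** A column with entries 1 and -1 is constant exactly when it is, up to sign, the column of ones,
    which is the product over the empty set. *)
Lemma in_estimable_effects S :
  (S \in estimable_effects X) = ~~ aliased X S set0.
Proof.
rewrite inE /defining_word; have [->|S0] /= := eqVneq S set0.
  by rewrite aliased_refl.
congr (~~ _); apply/forallP/orP => [cS|].
  have c0 i : col_prod X S i 0 = col_prod X S (Ordinal N0) 0.
    exact/eqP/(forallP (cS i)).
  case/orP: (pm1_col_prod S (Ordinal N0)) => /eqP cS0; [left|right];
    apply/eqP/colP => i; first by rewrite c0 cS0 col_prod_set0.
  by rewrite c0 cS0 [RHS]mxE col_prod_set0.
case=> /eqP-> i; apply/forallP => k; first by rewrite !col_prod_set0.
by rewrite [X in X == _]mxE [X in _ == X]mxE !col_prod_set0.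
Qed.

Lemma in_alias_sets C :
  reflect (exists2 S, ~~ aliased X S set0 & C = alias_class S)
          (C \in alias_sets X).
Proof.
(* Anything aliased with an estimable effect is itself estimable, so restricting the class to
   estimable effects changes nothing. *)
have clE S : ~~ aliased X S set0 ->
    [set T in estimable_effects X | aliased X S T] = alias_class S.
  move=> S0; apply/setP => T; rewrite [LHS]in_set [RHS]in_set.
  rewrite in_estimable_effects; apply: andb_idl => ST.
  by apply: contra S0; apply: aliased_trans.
apply: (iffP imsetP) => -[S S0 ->]; exists S; rewrite ?clE //.
all: by move: S0; rewrite ?in_estimable_effects.
Qed.

Lemma set0_notin_alias_sets : set0 \notin alias_sets X.
Proof.
apply/in_alias_sets => -[S _ /setP/(_ S)].
by rewrite !inE aliased_refl.
Qed.

Lemma trivial_class_notin_alias_sets : alias_class set0 \notin alias_sets X.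
Proof.
apply/in_alias_sets => -[S S0 /setP/(_ S)].
by rewrite !inE aliased_refl aliased_sym (negPf S0).
Qed.

End AliasClasses.

(** * The alias sets of the double *)

Section Double.

Local Open Scope ring_scope.

Variables (N n : nat) (X : 'M[int]_(N, n)).
Hypotheses (N0 : (0 < N)%N) (n0 : (0 < n)%N) (X1 : forall i j, pm1 (X i j)).
Implicit Types (S T : {set 'I_n}) (U V : {set 'I_(n + n)}).

Lemma pm1_double i j : pm1 (double_design X i j).
Proof.
rewrite /double_design -[i]splitK -[j]splitK.
case: (split i) => {}i; case: (split j) => {}j /=;
  rewrite ?block_mxEul ?block_mxEur ?block_mxEdl ?block_mxEdr ?X1 //.
by rewrite mxE; case/orP: (X1 i j) => /eqP->.
Qed.

Lemma col_prod_symdiff S T i :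
  col_prod X S i 0 * col_prod X T i 0 = col_prod X (symdiff S T) i 0.
Proof.
rewrite !mxE ![\prod_(j in _) _]big_mkcond -big_split; apply: eq_bigr => j _.
by rewrite inE /=; case: ifP; case: ifP; rewrite ?mulr1 ?mul1r // pm1_sqr.
Qed.

Lemma col_prod_double U :
  col_prod (double_design X) U =
  col_mx (col_prod X (fold U)) ((-1) ^+ parity U *: col_prod X (fold U)).
Proof.
apply/colP => k; rewrite mxE big_mkcond big_split_ord /= -[k]splitK.
case: (split k) => i /=; rewrite ?col_mxEu ?col_mxEd ?[in RHS](mxE scalemx_key);
  rewrite -col_prod_symdiff !mxE.
  congr (_ * _); rewrite [RHS]big_mkcond; apply: eq_bigr => j _; rewrite inE //.
    by rewrite block_mxEul.
  by rewrite block_mxEur.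
(* On the bottom half each factor from the right half carries a minus sign; the sign of the product
   is absorbed there. *)
rewrite mulrCA /parity signr_odd -prodrN; congr (_ * _);
  rewrite [RHS]big_mkcond; apply: eq_bigr => j _; rewrite inE.
  by rewrite block_mxEdl.
by rewrite block_mxEdr mxE.
Qed.

(** The top halves agree up to a sign, and the same sign must serve the bottom halves. A column with
    entries 1 and -1 differs from its negative, so this forces equal parities. *)
Lemma aliased_double U V :
  aliased (double_design X) U V
  = aliased X (fold U) (fold V) && (parity U == parity V).
Proof.
have eqcol (v1 v2 w1 w2 : 'cV[int]_N) :
    (col_mx v1 v2 == col_mx w1 w2) = (v1 == w1) && (v2 == w2).
  by apply/eqP/andP => [/eq_col_mx[-> ->]|[/eqP-> /eqP->]] //.
rewrite /aliased !col_prod_double opp_col_mx !eqcol -scalerN.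
set v := col_prod X (fold U); set w := col_prod X (fold V).
have vN : (v == - v) = false.
  apply/eqP => /matrixP/(_ (Ordinal N0) 0); rewrite [RHS]mxE.
  by case/orP: (pm1_col_prod X1 (fold U) (Ordinal N0)) => /eqP->.
have [vw|nvw] := eqVneq v w; first rewrite -vw vN /= orbF.
  by case: (parity U) (parity V) => [] [];
    rewrite ?scaleN1r ?scale1r ?eqxx ?vN // eq_sym vN.
have [vw|//] := eqVneq v (- w); rewrite /= vw.
have wN : (w == - w) = false by move: vN; rewrite vw opprK eq_sym.
by case: (parity U) (parity V) => [] [];
  rewrite ?scaleN1r ?scale1r ?opprK ?eqxx ?wN // eq_sym wN.
Qed.

Lemma alias_class_double U :
  alias_class (double_design X) U
  = lift_class (parity U) (alias_class X (fold U)).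
Proof.
by apply/setP => V; rewrite !inE aliased_double [parity U == _]eq_sym.
Qed.

Lemma fold0 : fold (set0 : {set 'I_(n + n)}) = set0.
Proof. by apply/setP => i; rewrite !inE. Qed.

Lemma parity0 : parity (set0 : {set 'I_(n + n)}) = false.
Proof.
rewrite /parity (_ : rhalf _ = set0) ?cards0 //.
by apply/setP => i; rewrite !inE.
Qed.

Lemma in_alias_sets_double D :
  reflect (D = lift_class true (alias_class X set0)
           \/ exists b, exists2 C, C \in alias_sets X & D = lift_class b C)
          (D \in alias_sets (double_design X)).
Proof.
have NN0 : (0 < N + N)%N by rewrite addn_gt0 N0.
apply: (iffP (in_alias_sets NN0 pm1_double D)) => [[U]|].
  rewrite aliased_double fold0 parity0 alias_class_double => U0 ->.
  (* If the fold is aliased with the empty set, estimability of [U] in the double leaves only odd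
     parity. *)
  have [fU|fU] := boolP (aliased X (fold U) set0); [left | right].
    move: U0; rewrite fU eqbF_neg negbK => ->; congr (lift_class _ _).
    apply/setP => S; rewrite !inE.
    apply/idP/idP; apply: aliased_trans => //.
    by rewrite aliased_sym.
  exists (parity U), (alias_class X (fold U)) => //.
  by apply/(in_alias_sets N0 X1); exists (fold U).
case=> [->|[b [C /(in_alias_sets N0 X1)[S S0 ->] ->]]].
  have [U fU pU] := exists_lift true set0 n0.
  by exists U; rewrite ?alias_class_double ?aliased_double fU pU // parity0 andbF.
have [U fU pU] := exists_lift b S n0.
exists U; rewrite ?alias_class_double ?aliased_double fU pU //.
by rewrite fold0 (negPf S0).
Qed.

(** With [s1] the classes free of main effects, the extra class closes the block of such classes in
    the double. *)
Definition double_seq (s1 s2 : seq {set {set 'I_n}}) :=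
  lift_seq s1 ++ lift_class true (alias_class X set0) :: lift_seq s2.

Lemma double_seq_spec s1 s2 : uniq (s1 ++ s2) -> s1 ++ s2 =i alias_sets X ->
  uniq (double_seq s1 s2) /\ double_seq s1 s2 =i alias_sets (double_design X).
Proof.
move=> us es; pose t := lift_class true (alias_class X set0).
have eq_perm : perm_eq (double_seq s1 s2) (t :: lift_seq (s1 ++ s2)).
  by rewrite /lift_seq allpairs_cat /double_seq perm_catC /= perm_cons perm_catC.
split.
  rewrite (perm_uniq eq_perm).
  (* Lifting the class of the empty set along with the others adds only its even lift at the head,
     which is dropped again. *)
  suff : uniq (lift_seq (alias_class X set0 :: s1 ++ s2)) by case/andP.
  apply: lift_seq_uniq => //=.
    rewrite inE es negb_or set0_notin_alias_sets // andbT eq_sym.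
    by apply/set0Pn; exists set0; rewrite inE aliased_refl.
  by rewrite es trivial_class_notin_alias_sets.
move=> D; rewrite (perm_mem eq_perm) inE.
apply/orP/in_alias_sets_double => [[/eqP->|/allpairsP[[C b] /= [Cs _ ->]]]|].
- by left.
- by right; exists b, C; rewrite // -es.
case=> [->|[b [C CX ->]]]; first by left.
by right; apply: allpairs_f; rewrite ?es //; case: b.
Qed.

End Double.

(** * Counting along an enumeration, and the theorem *)

Lemma num_alias_sets_size N n (X : 'M[int]_(N, n)) s :
  uniq s -> s =i alias_sets X -> num_alias_sets X = size s.
Proof. by move=> us es; rewrite -(card_uniqP us); apply/esym/eq_card. Qed.

Lemma num_alias_sets_no_main_count N n (X : 'M[int]_(N, n)) s :
  uniq s -> s =i alias_sets X ->
  num_alias_sets_no_main X = count (@no_main_effect n) s.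
Proof.
move=> us es; rewrite -size_filter -(card_uniqP (filter_uniq _ us)).
by apply: eq_card => C; rewrite inE mem_filter es andbC.
Qed.

Lemma resolution_at_leastP r N n (X : 'M[int]_(N, n)) S :
  resolution_at_least r X -> defining_word X S -> r <= #|S|.
Proof.
rewrite /resolution_at_least /resolution => + wS.
case: pickP => [S0 wS0|/(_ S)]; last by rewrite wS.
by case: arg_minnP => // S1 _ minS1 /leq_trans; apply; apply: minS1.
Qed.

(** Row [i] occurs at least once, so the boolean giving its multiplicity is true and the row is a
    solution. *)
Lemma regular_pm1 p N n (X : 'M[int]_(N, n)) i j : regular p X -> pm1 (X i j).
Proof.
case=> _ _ [S [eps [_ _ _ /(_ (row i X))]]].
have : 0 < #|[set k | row k X == row i X]| by apply/card_gt0P; exists i; rewrite inE.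
move=> + e; rewrite e lt0b => /andP[/forallP/(_ j)].
by rewrite mxE.
Qed.

Theorem theorem2p2 (N n p : nat) (X : 'M[int]_(N, n))
    (hreg : regular p X) (hres : resolution_at_least 3 X) :
  let g := num_alias_sets X in
  let f := num_alias_sets_no_main X in
  let g' := num_alias_sets (double_design X) in
  let f' := num_alias_sets_no_main (double_design X) in
  [/\ g' = 2 * g + 1,
      f' = 2 * f + 1
    & forall s : seq {set {set 'I_n}}, alias_ordering X s ->
      exists s' : seq {set {set 'I_(n + n)}},
        [/\ alias_ordering (double_design X) s',
            forall i, 1 <= i <= f ->
              num_tfi s' (2 * i - 1) = 2 * num_tfi s i /\
              num_tfi s' (2 * i) = 2 * num_tfi s i,
            num_tfi s' (2 * f + 1) = n
          & forall i, f + 1 <= i <= g ->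
              num_tfi s' (2 * i) = 2 * num_tfi s i /\
              num_tfi s' (2 * i + 1) = 2 * num_tfi s i]].
Proof.
move=> g f g' f'.
have X1 i j : pm1 (X i j) by apply: regular_pm1 hreg.
have [pn eN _] := hreg.
have N0 : 0 < N by rewrite eN expn_gt0.
have n0 : 0 < n by apply: leq_ltn_trans pn.
pose triv := alias_class X set0.
(* Apart from the empty set, [triv] holds only defining words. Resolution III therefore keeps main
   effects and two-factor interactions out of it. *)
have triv_card S : S \in triv -> S != set0 -> 3 <= #|S|.
  move=> St S0; apply: (resolution_at_leastP hres).
  move: St; rewrite inE aliased_sym => St.
  by move: (in_estimable_effects N0 X1 S); rewrite inE S0 St; case: defining_word.
have triv_main : no_main_effect triv.
  apply/forall_inP => S St; apply/negP => /eqP S1.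
  by have := triv_card S St; rewrite -cards_eq0 S1 => /(_ isT).
have triv_tfi : #|[set S in triv | two_factor_interaction S]| = 0.
  apply/eqP; rewrite cards_eq0; apply/eqP/setP => S; rewrite inE [RHS]inE.
  apply/negP => /andP[St /eqP S2].
  by have := triv_card S St; rewrite -cards_eq0 S2 => /(_ isT).
have eqf' : f' = 2 * f + 1.
  (* For counting alone the order is irrelevant, so the extra class may come first. *)
  have [] := @double_seq_spec _ _ X N0 n0 X1 [::] (enum (alias_sets X)).
  - exact: enum_uniq.
  - exact: mem_enum.
  move=> us' es'.
  rewrite /f' (num_alias_sets_no_main_count us' es') /= -/(lift_seq _).
  rewrite count_no_main_lift_seq no_main_effect_lift triv_main.
  by rewrite -(num_alias_sets_no_main_count (enum_uniq _) (mem_enum _)) addnC.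
split=> //.
  have [] := @double_seq_spec _ _ X N0 n0 X1 [::] (enum (alias_sets X)).
  - exact: enum_uniq.
  - exact: mem_enum.
  move=> us' es'.
  rewrite /g' (num_alias_sets_size us' es') /= -/(lift_seq _) size_lift_seq.
  by rewrite -(num_alias_sets_size (enum_uniq _) (mem_enum _)) addn1.
move=> s [us es hs].
have szs : size s = g by rewrite /g (num_alias_sets_size us es).
have fs : f <= size s.
  by rewrite /f (num_alias_sets_no_main_count us es) count_size.
have szf : size (take f s) = f by rewrite size_take_min; apply/minn_idPl.
(* Cutting [s] after its first [f] classes puts the extra class at index [2 * f] from zero, that is,
   in position [2 * f + 1]. *)
pose s' := double_seq X (take f s) (drop f s).
have [us' es'] : uniq s' /\ s' =i alias_sets (double_design X).
  by apply: double_seq_spec => //; rewrite cat_take_drop.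
have nth_lo k : k < 2 * f ->
    nth set0 s' k = lift_class (odd k) (nth set0 s k./2).
  move=> kf; rewrite nth_cat size_lift_seq szf kf nth_lift_seq nth_take //; lia.
have nth_mid : nth set0 s' (2 * f) = lift_class true triv.
  by rewrite nth_cat size_lift_seq szf ltnn subnn.
have nth_hi k : 2 * f <= k ->
    nth set0 s' k.+1 = lift_class (odd k) (nth set0 s k./2).
  move=> kf; rewrite nth_cat size_lift_seq szf ltnNge ltnW //=.
  rewrite subSn //= nth_lift_seq nth_drop; congr (lift_class _ (nth _ _ _)); lia.
(* An alias set does not contain the empty set, so the summand [n] is absent and both parities give
   the same count. *)
have tfi_lift b i : 1 <= i <= g ->
    #|[set U in lift_class b (nth set0 s i.-1) | two_factor_interaction U]|
    = 2 * num_tfi s i.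
  move=> ig; rewrite /num_tfi; case: b; last exact: card_tfi_lift_false.
  have : nth set0 s i.-1 \in alias_sets X by rewrite -es mem_nth // szs; lia.
  case/(in_alias_sets N0 X1) => S S0 ->.
  by rewrite card_tfi_lift_true [set0 \in _]inE (negPf S0) addn0.
have size_s' : size s' = 2 * size s + 1.
  by rewrite size_cat /= !size_lift_seq szf size_drop; lia.
exists s'; split.
- split=> // k; rewrite -/f' eqf' size_s' => ks.
  have [kf|kf|->] := ltngtP k (2 * f).
  + by rewrite nth_lo // no_main_effect_lift hs -/f; lia.
  + case: k kf ks => // k kf ks.
    by rewrite nth_hi // no_main_effect_lift hs -/f; lia.
  + by rewrite nth_mid no_main_effect_lift triv_main; lia.
- move=> i i_f; have ig : 1 <= i <= g by lia.
  rewrite {1 3}/num_tfi !nth_lo; try lia.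
  have -> : (2 * i - 1).-1./2 = i.-1 by lia.
  have -> : (2 * i).-1./2 = i.-1 by lia.
  by rewrite !tfi_lift.
- rewrite /num_tfi addn1 /= nth_mid card_tfi_lift_true triv_tfi.
  by rewrite inE aliased_refl mul1n.
- move=> i i_f; have ig : 1 <= i <= g by lia.
  (* Past the extra class, indices from zero are shifted by one; they are written as successors to
     match [nth_hi]. *)
  have [e1 e2] : (2 * i).-1 = (2 * i.-1).+1 /\ (2 * i + 1).-1 = (2 * i.-1).+2.
    by split; lia.
  rewrite {1 3}/num_tfi e1 e2 !nth_hi; try lia.
  have -> : (2 * i.-1)./2 = i.-1 by lia.
  have -> : (2 * i.-1).+1./2 = i.-1 by lia.
  by rewrite !tfi_lift.
Qed.
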